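(* For a positive integer $n$, let $A(n)$ denote the number of partitions of $n$ into parts $\equiv \pm 1,\pm 3 \pmod 7$. Let $B(n)$ denote the number of bipartitions $(\pi,\lambda)$ of $n$, where $\pi$ is a partition into distinct even parts greater than $2$ with a gap of at least $4$ between consecutive parts, and $\lambda$ is a partition into distinct parts such that if $e_j$ is the $j$-th part in $\pi$ (where the parts are ordered in ascending order), then the parts $e_j/2-1$, $e_j/2$ and $e_j/2+1$ are not present in $\lambda$. Let $C(n)$ denote the number of bipartitions $(\pi,\mu)$ of $n$, where $\pi$ is a partition into distinct even parts greater than $2$ with a gap of at least $4$ between consecutive parts, and $\mu$ is a partition into distinct parts such that if $e_j$ is the $j$-th part in $\pi$ (where the parts are ordered in ascending order), then the parts $e_j/2+j-2$, $e_j/2+j-1$ and $e_j/2+j$ are not present in $\mu$. Then $A(n)=B(n)=C(n)$ for every positive integer $n$.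
   Context: The union $\pi\cup\lambda$ of partitions $\pi$ and $\lambda$ is the partition whose parts are those of $\pi$ and $\lambda$ together (with multiplicity), arranged in non-increasing order. A bipartition of a positive integer $n$ is an ordered pair of partitions $(\pi,\lambda)$ such that $\pi\cup\lambda$ is a partition of $n$; $\pi$ or $\lambda$ may be empty. The exclusion conditions are imposed for every part $e_j$ of $\pi$, where $e_1<e_2<\cdots$ are the parts of $\pi$. *)

(* Defs.v *)
From HB Require Import structures.
From mathcomp Require Import all_boot.

Set Implicit Arguments.
Unset Strict Implicit.
Unset Printing Implicit Defensive.

(* The parts are listed in non-increasing order. *)
Definition is_part (s : seq nat) : bool := sorted geq s && (0 \notin s).

Definition is_partn (n : nat) (s : seq nat) : bool :=
  is_part s && (sumn s == n).

Definition part_union (p l : seq nat) : seq nat := sort geq (p ++ l).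

Definition is_bipartn (n : nat) (b : seq nat * seq nat) : bool :=
  [&& is_part b.1, is_part b.2 & is_partn n (part_union b.1 b.2)].

Record intpartn (n : nat) : Type :=
  Intpartn { intpartn_val :> seq nat; _ : is_partn n intpartn_val }.

Record bipartn (n : nat) : Type :=
  Bipartn { bipartn_val :> seq nat * seq nat; _ : is_bipartn n bipartn_val }.

HB.instance Definition _ n := [isSub for @intpartn_val n].
HB.instance Definition _ n := [Countable of intpartn n by <:].
HB.instance Definition _ n := [isSub for @bipartn_val n].
HB.instance Definition _ n := [Countable of bipartn n by <:].

(* Both types are finite: a partition of m <= n has at most n parts,
   each of them at most n. *)
Definition bounded_seqs (n : nat) : seq (seq nat) :=
  undup [seq map val (bseqval s) | s <- enum {: n.-bseq 'I_n.+1}].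

Lemma mem_bounded_seqs n s :
  is_part s -> sumn s <= n -> s \in bounded_seqs n.
Proof.
case/andP=> _ s_gt0 le_s_n.
have [size_s s_le]: size s <= sumn s /\ all (fun x => x <= sumn s) s.
  elim: s s_gt0 {le_s_n} => //= x s IHs; rewrite inE negb_or eq_sym -lt0n.
  case/andP=> x_gt0 /IHs[size_s s_le]; split.
    by rewrite -add1n leq_add.
  rewrite leq_addr; apply: sub_all s_le => y le_y.
  exact: leq_trans le_y (leq_addl _ _).
have size_t: size (map (@inord n) s) <= n.
  by rewrite size_map (leq_trans size_s).
rewrite mem_undup; apply/mapP; exists (Bseq size_t); first by rewrite mem_enum.
rewrite /= -map_comp map_id_in // => x /(allP s_le) le_x /=.
by rewrite inordK // ltnS (leq_trans le_x).
Qed.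

Lemma sumn_part_union p l : sumn (part_union p l) = sumn p + sumn l.
Proof. by rewrite /part_union -sumn_cat; apply/perm_sumn/permEl/perm_sort. Qed.

Definition intpartn_enum (n : nat) : seq (intpartn n) :=
  pmap insub (bounded_seqs n).

Lemma intpartn_enumP n : Finite.axiom (intpartn_enum n).
Proof.
move=> p; rewrite count_uniq_mem; last exact/pmap_sub_uniq/undup_uniq.
rewrite mem_pmap_sub mem_bounded_seqs //; case: p => s /= /andP[//] _.
by move/eqP->.
Qed.

HB.instance Definition _ n := isFinite.Build (intpartn n) (@intpartn_enumP n).

Definition bipartn_enum (n : nat) : seq (bipartn n) :=
  pmap insub [seq (p, l) | p <- bounded_seqs n, l <- bounded_seqs n].

Lemma bipartn_enumP n : Finite.axiom (bipartn_enum n).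
Proof.
move=> b; rewrite count_uniq_mem; last first.
  by apply/pmap_sub_uniq/allpairs_uniq; rewrite ?undup_uniq // => -[? ?] [].
rewrite mem_pmap_sub; case: b => -[p l] /= /and3P[/= p_part l_part].
case/andP=> _; rewrite sumn_part_union => /eqP def_n.
rewrite allpairs_f // mem_bounded_seqs // -def_n.
  exact: leq_addr.
exact: leq_addl.
Qed.

HB.instance Definition _ n := isFinite.Build (bipartn n) (@bipartn_enumP n).

(* x is congruent to a or to - a modulo m *)
Definition congr_pm (a m x : nat) : bool :=
  (x == a %[mod m]) || (x + a == 0 %[mod m]).

(* The j-th part (j >= 1) of p when the parts are put in ascending order. *)
Definition asc_part (p : seq nat) (j : nat) : nat := nth 0 (rev p) j.-1.

Definition gap_even_part (p : seq nat) : bool :=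
  [&& uniq p, all (fun e => ~~ odd e && (2 < e)) p
    & sorted (fun x y => y + 4 <= x) p].

(* Since e_j >= 4 and j >= 1, the subtractions below never truncate. *)
Definition B_excluded (p l : seq nat) : bool :=
  all (fun j => let e := asc_part p j in
         [&& e %/ 2 - 1 \notin l, e %/ 2 \notin l & e %/ 2 + 1 \notin l])
      (iota 1 (size p)).

Definition C_excluded (p m : seq nat) : bool :=
  all (fun j => let e := asc_part p j in
         [&& e %/ 2 + j - 2 \notin m, e %/ 2 + j - 1 \notin m
           & e %/ 2 + j \notin m])
      (iota 1 (size p)).

Definition A (n : nat) : nat :=
  #|[set p : intpartn n | all (fun x => congr_pm 1 7 x || congr_pm 3 7 x) p]|.

Definition B (n : nat) : nat :=
  #|[set b : bipartn n |
      [&& gap_even_part b.1, uniq b.2 & B_excluded b.1 b.2]]|.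

Definition C (n : nat) : nat :=
  #|[set b : bipartn n |
      [&& gap_even_part b.1, uniq b.2 & C_excluded b.1 b.2]]|.

(* Main.v *)
(* Halve the parts of pi and regard each half e/2 as a part occurring twice: the
   pairs counted by B become the partitions with f_1 <= 1 and
   f_i + f_(i+1) <= 2, where f_i is the multiplicity of i, so A = B is Gordon's
   theorem modulo 7.  Andrews' series J_{3,i}(q^s; q) satisfy the recursion in s
   of the generating functions of such partitions with all parts > s, and at
   s = 0, i = 2 Jacobi's triple product turns them into the product for A.

   For B = C, fix the number r of parts of pi.  Summing over the halves one at a
   time telescopes, in both cases, to
     q^(2r^2+2r) (-q^(2r+1); q)_oo / (q^2; q^2)_r :
   the excluded triples may overlap in B and are disjoint in C, and the shift by
   j - 1 in C compensates exactly for this.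

   Everything takes place in a commutative ring with q^(N+1) = 0, where the
   infinite sums and products are finite and the factors 1 - q^i are regular. *)
Require Import Defs.
From mathcomp Require Import all_boot.
From mathcomp Require Import all_algebra.
From mathcomp Require Import qpoly ring zify.

Set Implicit Arguments.
Unset Strict Implicit.
Unset Printing Implicit Defensive.

Import GRing.Theory.

(** * Enumerating the partitions *)

(** An entry x stands for the part 2x of pi: gaps of at least 4 between even parts become gaps of at
    least 2, and parts above 2 correspond to a = 1. *)
Fixpoint gap2_lists (N r a : nat) : seq (seq nat) :=
  if r is r'.+1 then
    [seq x :: s | x <- iota a.+1 (N - a), s <- gap2_lists N r' x.+1]
  else [:: [::]].

(* For the ascending list s of halves of parts of pi, the excluded values: the
   triple of the j-th half is shifted by c + d (j - 1), with d = 0 in B and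
   d = 1 in C. *)
Fixpoint shifted_triples (d c : nat) (s : seq nat) : seq nat :=
  if s is x :: s' then
    [:: (x + c).-1; x + c; (x + c).+1] ++ shifted_triples d (c + d) s'
  else [::].

Lemma gap2_listsS N r a : gap2_lists N r.+1 a =
  if a < N then [seq a.+1 :: s | s <- gap2_lists N r a.+2]
                 ++ gap2_lists N r.+1 a.+1
  else [::].
Proof.
rewrite /=; case: ltnP => [lt_aN|/eqP->] //.
by rewrite -[N - a]prednK ?subn_gt0 //= subnS.
Qed.

Lemma shifted_triples_ge N d r c a s i :
  s \in gap2_lists N r a -> i \in shifted_triples d c s -> a + c <= i.
Proof.
elim: r c a s => [|r IHr] c a s /=; first by rewrite inE => /eqP->.
case/allpairsPdep=> x [s' [+ /IHr s'_ge ->]]; rewrite mem_iota => x_ge.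
rewrite !inE /= => /or4P[/eqP->|/eqP->|/eqP->|/s'_ge]; lia.
Qed.

(** The multiplicities are chosen independently of each other, so that the generating function is a
    product over the parts. *)
Fixpoint mult_lists (c : nat -> nat) (m : nat) : seq (seq nat) :=
  if m is m'.+1 then
    [seq nseq k m ++ l | k <- iota 0 (c m), l <- mult_lists c m']
  else [:: [::]].

Lemma geq_trans : transitive geq.
Proof. by move=> y x z /= le_yx le_zy; apply: leq_trans le_yx. Qed.

Lemma count_mem_le_sumn x l : count_mem x l * x <= sumn l.
Proof.
elim: l => //= y l IHl; rewrite mulnDl leq_add //.
by case: eqP => [->|_]; rewrite ?mul1n.
Qed.

Lemma mem_mult_lists c m l : (l \in mult_lists c m) =
  [&& sorted geq l, all (fun x => 0 < x <= m) l
    & all (fun x => count_mem x l < c x) (iota 1 m)].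
Proof.
elim: m l => [|m IHm] l.
  rewrite inE andbT; case: l => //= x l.
  by rewrite leqn0; case: x => [|x] //=; rewrite andbF.
have := iotaD 1 m 1; rewrite addn1 add1n => ->.
rewrite all_cat [all _ [:: _]]/= andbT.
apply/allpairsPdep/and3P => [[k [l' []]]|[l_sorted l_le /andP[l_count m_count]]].
  rewrite mem_iota IHm => /= lt_kc /and3P[l'_sorted l'_le l'_count] ->.
  have notin x : m < x -> count_mem x l' = 0.
    move=> lt_mx; apply/count_memPn/negP => /(allP l'_le); lia.
  split.
  - elim: k {lt_kc} => //= k IHk; rewrite (path_sortedE geq_trans) IHk andbT.
    rewrite all_cat all_nseq /= leqnn orbT /=.
    by apply: sub_all l'_le => x /=; lia.
  - rewrite all_cat all_nseq /= leqnn orbT /=.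
    by apply: sub_all l'_le => x /=; lia.
  - rewrite count_cat count_nseq /= eqxx mul1n notin // addn0 lt_kc andbT.
    apply/allP => x x_in; rewrite count_cat count_nseq /=.
    have /negPf->: m.+1 != x by move: x_in; rewrite mem_iota; lia.
    by rewrite mul0n (allP l'_count).
exists (count_mem m.+1 l), [seq x <- l | x != m.+1]; split.
- by rewrite mem_iota.
- rewrite IHm; apply/and3P; split.
  + exact/sorted_filter/l_sorted/geq_trans.
  + apply/allP => x; rewrite mem_filter => /andP[neq_x /(allP l_le)]; lia.
  + apply/allP => x x_in; apply: leq_ltn_trans (allP l_count x x_in).
    by rewrite count_filter sub_count // => y /andP[].
(* Both lists are non-increasing, so it suffices that one is a permutation of the other. *)
apply: (sorted_eq geq_trans) => //.
- by move=> x y; rewrite /geq /= => /andP[]; lia.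
- elim: (count_mem _ _) => [|k IHk] /=; first exact/sorted_filter/l_sorted/geq_trans.
  rewrite (path_sortedE geq_trans) IHk andbT all_cat all_nseq /= leqnn orbT /=.
  by apply/allP => x; rewrite mem_filter => /andP[_ /(allP l_le)] /andP[].
rewrite -(perm_filterC (pred1 m.+1)) perm_cat2r.
have /all_pred1P-> := filter_all (pred1 m.+1) l.
by rewrite size_filter.
Qed.

(** The multiplicity of m+1 recovers k, as the lists for m contain no m+1. *)
Lemma mult_lists_uniq c m : uniq (mult_lists c m).
Proof.
elim: m => //= m IHm; apply: allpairs_uniq => // [|[k l] [k' l']].
  exact: iota_uniq.
have count0 s : s \in mult_lists c m -> count_mem m.+1 s = 0.
  rewrite mem_mult_lists => /and3P[_ s_le _].
  by apply/count_memPn/negP => /(allP s_le); rewrite ltnn andbF.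
case/allpairsP=> -[k1 l1] [/= _ /count0 l0 [-> ->]].
case/allpairsP=> -[k2 l2] [/= _ /count0 l0' [-> ->]] /= eq_l.
have := congr1 (count_mem m.+1) eq_l.
rewrite !count_cat !count_nseq /= eqxx !mul1n l0 l0' !addn0 => eq_k.
by move/eqP: eq_l; rewrite eq_k eqseq_cat // => /andP[_ /eqP->].
Qed.

Lemma mem_gap2_lists N r a s : (s \in gap2_lists N r a) =
  [&& size s == r, all (fun x => a < x <= N) s & sorted (fun x y => x.+2 <= y) s].
Proof.
have ltn2_trans : transitive (fun x y => x.+2 <= y) by move=> y x z; lia.
elim: r a s => [|r IHr] a s; first by rewrite inE; case: s.
apply/allpairsPdep/idP => [[x [l [+ + ->]]]|].
  rewrite mem_iota IHr /= (path_sortedE ltn2_trans) eqSS.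
  move=> x_in /and3P[-> l_in ->]; rewrite andbT /= -andbA; apply/and3P; split.
  - by lia.
  - by apply: sub_all l_in => y; lia.
  - by apply: sub_all l_in => y; lia.
case: s => [|x s] //=; rewrite (path_sortedE ltn2_trans) eqSS.
case/and3P=> size_s /andP[x_in s_in] /andP[x_lt s_sorted].
exists x, s; rewrite mem_iota IHr size_s s_sorted andbT; split=> //; first lia.
apply/allP => y y_in; have := allP x_lt y y_in; have := allP s_in y y_in; lia.
Qed.

Lemma gap2_lists_uniq N r a : uniq (gap2_lists N r a).
Proof.
elim: r a => //= r IHr a; apply: allpairs_uniq_dep => [||[x l] [y l'] _ _ [-> ->]] //.
exact: iota_uniq.
Qed.

Lemma all_shifted_triples (Q : pred nat) d c s : all Q (shifted_triples d c s) =
  all (fun i => let m := nth 0 s i + (c + d * i) in [&& Q m.-1, Q m & Q m.+1])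
      (iota 0 (size s)).
Proof.
elim: s c => //= x s IHs c; rewrite IHs muln0 addn0 -!andbA -[1]addn0 iotaDl.
rewrite all_map; do 3!congr (_ && _).
by apply: eq_all => i /=; rewrite add1n /= mulnS !addnA.
Qed.

Lemma mem_mult_lists_part c N l : (forall i, 0 < c i) -> sumn l <= N ->
  (l \in mult_lists c N) = is_part l && all (fun x => count_mem x l < c x) l.
Proof.
move=> c_gt0 le_lN; rewrite mem_mult_lists /is_part -andbA; congr (_ && _).
have -> : all (fun x => 0 < x <= N) l = (0 \notin l).
  apply/allP/idP => [in_l|l_gt0 x xl]; first by apply/negP => /in_l.
  have x_gt0 : 0 < x by rewrite lt0n; apply: contraNneq l_gt0 => <-.
  rewrite x_gt0 (leq_trans _ le_lN) // (leq_trans _ (count_mem_le_sumn x l)) //.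
  by rewrite leq_pmull // -has_count has_pred1.
case: (boolP (0 \in l)) => //= l_gt0; apply/allP/allP => l_count x x_in.
  apply: l_count; rewrite mem_iota; have := count_mem_le_sumn x l.
  have : 0 < count_mem x l by rewrite -has_count has_pred1.
  by have : x != 0 by [apply: contraNneq l_gt0 => <-]; nia.
have [/l_count //|/count_memPn->] := boolP (x \in l).
exact: c_gt0.
Qed.

Lemma uniq_count_le1 (l : seq nat) : all (fun x => count_mem x l <= 1) l = uniq l.
Proof.
apply/allP/idP => [l_count|uniq_l x _]; last first.
  by rewrite count_uniq_mem // leq_b1.
apply: count_mem_uniq => x; have [xl|/count_memPn//] := boolP (x \in l).
by apply/eqP; rewrite eqn_leq l_count //= -has_count has_pred1.
Qed.

(** The bounds of [mult_lists] are strict: 1 forbids a part, 2 allows it once. *)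
Definition distinct_bound (E : seq nat) (i : nat) : nat :=
  if i \in E then 1 else 2.

Lemma mem_distinct_lists E N l : sumn l <= N ->
  (l \in mult_lists (distinct_bound E) N) =
  [&& is_part l, uniq l & all (fun i => i \notin l) E].
Proof.
move=> le_lN; rewrite mem_mult_lists_part // => [|i]; last first.
  by rewrite /distinct_bound; case: ifP.
congr (_ && _); rewrite -uniq_count_le1 all_predC (has_sym l) -all_predC -all_predI.
apply: eq_in_all => x xl /=; rewrite /distinct_bound.
have : 0 < count_mem x l by rewrite -has_count has_pred1.
by case: ifP => _; rewrite ?andbT ?andbF ?ltnS //; case: count.
Qed.

Definition pm13_mod7 (i : nat) : bool := congr_pm 1 7 i || congr_pm 3 7 i.

(** A positive part occurs at most N times when the sum is at most N, so N+1 is no restriction. *)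
Definition part_bound (N i : nat) : nat := if pm13_mod7 i then N.+1 else 1.

Lemma mem_part_lists N l : sumn l <= N ->
  (l \in mult_lists (part_bound N) N) = is_part l && all pm13_mod7 l.
Proof.
move=> le_lN; rewrite mem_mult_lists_part // => [|i]; last first.
  by rewrite /part_bound; case: ifP.
case: (boolP (is_part l)) => //= /andP[_ l_gt0]; apply: eq_in_all => x xl.
rewrite /part_bound; have := count_mem_le_sumn x l.
have : 0 < count_mem x l by rewrite -has_count has_pred1.
have : x != 0 by apply: contraNneq l_gt0 => <-.
by move: (count_mem x l) (sumn l) le_lN => k m le_mN; case: ifP => _; nia.
Qed.

(** More than N positive parts would sum to more than N, so r stops at N. *)
Definition gap_part_halves (N : nat) : seq (seq nat) :=
  flatten [seq gap2_lists N r 1 | r <- iota 0 N.+1].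

Lemma gap_part_halves_uniq N : uniq (gap_part_halves N).
Proof.
rewrite /gap_part_halves; move: (iota_uniq 0 N.+1); elim: (iota _ _) => //= r rs IHr.
case/andP=> r_notin /IHr IHn; rewrite cat_uniq gap2_lists_uniq IHn andbT.
apply/hasPn => s /flatten_mapP[r'].
rewrite !mem_gap2_lists => r'_in /andP[/eqP-> _] /=.
by apply: contraNN r_notin => /andP[/eqP<-].
Qed.

Lemma gap_even_partP N p : sumn p <= N ->
  reflect (exists2 s, s \in gap_part_halves N & p = rev (map double s))
          (is_part p && gap_even_part p).
Proof.
move=> le_pN; apply: (iffP idP) => [|[s s_in ->]]; last first.
  move: s_in => /flatten_mapP[r _]; rewrite mem_gap2_lists => /and3P[_ s_le s_gap].
  have s_sorted (e : rel nat) : (forall x y, x.+2 <= y -> e y.*2 x.*2) ->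
      sorted e (rev (map double s)).
    by move=> e_gap; rewrite rev_sorted sorted_map; apply: sub_sorted s_gap.
  rewrite /is_part /gap_even_part !s_sorted /=; try by move=> x y; lia.
  rewrite andbT; apply/and3P; split.
  - rewrite mem_rev; apply/negP => /mapP[x /(allP s_le)]; lia.
  - rewrite rev_uniq map_inj_uniq; last by move=> x y; lia.
    by apply: sorted_uniq s_gap => [y x z|x]; lia.
  - by rewrite all_rev all_map; apply: sub_all s_le => x /=; lia.
case/andP=> /andP[_ p_gt0] /and3P[_ p_even p_gap].
have def_p : p = rev (map double (map half (rev p))).
  rewrite -[LHS]revK -map_comp; congr rev; rewrite map_id_in // => x.
  by rewrite mem_rev => /(allP p_even) /=; lia.
exists (map half (rev p)) => //; apply/flatten_mapP; exists (size p).
  have size_le (t : seq nat) : 0 \notin t -> size t <= sumn t.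
    by elim: t => //= x t IHt; rewrite inE negb_or => /andP[? /IHt]; lia.
  by rewrite mem_iota add0n ltnS (leq_trans (size_le _ p_gt0)).
rewrite mem_gap2_lists size_map size_rev eqxx /=; apply/andP; split.
  rewrite all_map all_rev; apply/allP => x xp /=.
  have := allP p_even x xp => /= /andP[x_even x_gt2].
  have := count_mem_le_sumn x p.
  have : 0 < count_mem x p by rewrite -has_count has_pred1.
  nia.
rewrite sorted_map rev_sorted; apply: sub_sorted p_gap => x y /=; lia.
Qed.

Lemma nth_map_double s i : nth 0 (map double s) i = (nth 0 s i).*2.
Proof. by elim: s i => [|x s IHs] [|i] //=. Qed.

Lemma B_excludedE s l : B_excluded (rev (map double s)) l =
  all (fun i => i \notin l) (shifted_triples 0 0 s).
Proof.
rewrite /B_excluded /asc_part revK size_rev size_map all_shifted_triples.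
have := iotaDl 1 0 (size s); rewrite addn0 => ->; rewrite all_map.
apply: eq_all => i /=.
by rewrite nth_map_double divn2 doubleK mul0n !addn0 subn1 addn1.
Qed.

(** Counted from 0, the j-th half has index i = j - 1, and e_j/2 + j - 1 is this half shifted by i;
    hence d = 1. *)
Lemma C_excludedE s l : C_excluded (rev (map double s)) l =
  all (fun i => i \notin l) (shifted_triples 1 0 s).
Proof.
rewrite /C_excluded /asc_part revK size_rev size_map all_shifted_triples.
have := iotaDl 1 0 (size s); rewrite addn0 => ->; rewrite all_map.
apply: eq_all => i /=.
rewrite nth_map_double divn2 doubleK mul1n add0n addnS.
by rewrite subSS subn1 subSS subn0.
Qed.

Definition bipart_lists (d N : nat) : seq (seq nat * seq nat) :=
  [seq (rev (map double s), l) | s <- gap_part_halves N,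
     l <- mult_lists (distinct_bound (shifted_triples d 0 s)) N].

Lemma bipart_lists_uniq d N : uniq (bipart_lists d N).
Proof.
apply: allpairs_uniq_dep => [|s _|[s l] [s' l'] _ _ /= [eq_s ->]].
- exact: gap_part_halves_uniq.
- exact: mult_lists_uniq.
by have /inj_map-> // := can_inj revK eq_s; apply: (can_inj doubleK).
Qed.

(** The exclusion condition is a parameter, so that both [B_excludedE] (d = 0) and [C_excludedE] (d
    = 1) fit. *)
Lemma mem_bipart_lists d N (excl : seq nat -> seq nat -> bool) b :
  (forall s l, excl (rev (map double s)) l =
     all (fun i => i \notin l) (shifted_triples d 0 s)) ->
  (b \in [seq b <- bipart_lists d N | sumn b.1 + sumn b.2 == N]) =
  is_bipartn N b && [&& gap_even_part b.1, uniq b.2 & excl b.1 b.2].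
Proof.
move=> exclE; case: b => p l; rewrite mem_filter /is_bipartn /is_partn /=.
rewrite sumn_part_union; have [eq_N|] := eqVneq; last by rewrite !andbF.
have le_pN : sumn p <= N by rewrite -eq_N leq_addr.
have le_lN : sumn l <= N by rewrite -eq_N leq_addl.
have -> : [&& is_part p, is_part l & is_part (part_union p l) && true] =
    is_part p && is_part l.
  rewrite andbT andbA andb_idr // => /andP[/andP[_ p_gt0] /andP[_ l_gt0]].
  rewrite /is_part /part_union mem_sort mem_cat negb_or p_gt0 l_gt0 !andbT.
  by apply: sort_sorted => x y; apply: leq_total.
transitivity ((is_part p && gap_even_part p) && [&& is_part l, uniq l & excl p l]).
  apply/allpairsPdep/idP => [[s [l' [s_in + [def_p def_l]]]]|].
    rewrite -def_l mem_distinct_lists // -exclE -def_p => ->; rewrite andbT.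
    by apply/(gap_even_partP le_pN); exists s.
  case/andP=> /(gap_even_partP le_pN)[s s_in def_p] l_in.
  by exists s, l; rewrite mem_distinct_lists // -exclE -def_p.
by case: is_part; case: is_part; rewrite ?andbF.
Qed.

Lemma card_val_seq (U : choiceType) (P : pred U) (T : subFinType P) (Q : pred U)
    (s : seq U) :
  uniq s -> (forall u, (u \in s) = P u && Q u) ->
  #|[set x : T | Q (val x)]| = size s.
Proof.
move=> s_uniq sE; rewrite cardE -(size_map val); apply/perm_size/uniq_perm => //.
  by rewrite map_inj_uniq ?enum_uniq //; apply: val_inj.
move=> u; rewrite sE; apply/mapP/andP => [[x]|[Pu Qu]].
  by rewrite mem_enum inE => Qx ->; rewrite (valP x).
by exists (Sub u Pu); rewrite ?mem_enum ?inE SubK.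
Qed.

Lemma A_count n :
  A n = count (fun l => sumn l == n) (mult_lists (part_bound n) n).
Proof.
rewrite -size_filter /A; apply: (@card_val_seq _ _ _ (all pm13_mod7)).
  exact/filter_uniq/mult_lists_uniq.
move=> l; rewrite mem_filter /is_partn.
have [eq_n|] := eqVneq; last by rewrite andbF.
by rewrite andbT mem_part_lists // eq_n.
Qed.

Lemma B_count n :
  B n = count (fun b => sumn b.1 + sumn b.2 == n) (bipart_lists 0 n).
Proof.
rewrite -size_filter /B; apply: (@card_val_seq _ _ _
  (fun b => [&& gap_even_part b.1, uniq b.2 & B_excluded b.1 b.2])).
  exact/filter_uniq/bipart_lists_uniq.
by move=> b; rewrite (mem_bipart_lists _ _ B_excludedE).
Qed.

Lemma C_count n :
  C n = count (fun b => sumn b.1 + sumn b.2 == n) (bipart_lists 1 n).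
Proof.
rewrite -size_filter /C; apply: (@card_val_seq _ _ _
  (fun b => [&& gap_even_part b.1, uniq b.2 & C_excluded b.1 b.2])).
  exact/filter_uniq/bipart_lists_uniq.
by move=> b; rewrite (mem_bipart_lists _ _ C_excludedE).
Qed.

(** * The finite triple product *)

Section FiniteTripleProduct.

Local Open Scope ring_scope.

Variables (R : comNzRingType) (p : R).

(* The Gaussian binomial coefficient [2m, m + n]_p. *)
Fixpoint cbin (m n : nat) : R :=
  if m is m'.+1 then
    (1 + p ^+ m'.*2.+1) * cbin m' n + p ^+ (m' + n).+1 * cbin m' n.+1
    + (if n is n'.+1 then p ^+ (m' - n') * cbin m' n'
       else p ^+ m'.+1 * cbin m' 1)
  else (n == 0)%:R.

Lemma cbin_small m n : (m < n)%N -> cbin m n = 0.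
Proof.
elim: m n => [|m IHm] [|n] //= lt_mn.
by rewrite !IHm ?mulr0 ?addr0 //; lia.
Qed.

Definition qfact (n : nat) : R := \prod_(1 <= i < n.+1) (1 - p ^+ i).

Lemma qfactS n : qfact n.+1 = qfact n * (1 - p ^+ n.+1).
Proof. by rewrite /qfact big_nat_recr. Qed.

(** The recurrence defining [cbin] is two Pascal steps in one, with index -1 replaced by 1 by
    symmetry. Factorials are multiplied across instead of divided by. *)
Lemma cbinE m n : (n <= m)%N ->
  cbin m n * (qfact (m - n) * qfact (m + n)) = qfact m.*2.
Proof.
elim: m n => [|m IHm] n le_nm.
  by move: le_nm; rewrite leqn0 => /eqP->; rewrite /qfact !big_geq ?mulr1.
(* [mid], [up] and [down] bring the three terms of the recurrence over the common factor
   [qfact m.*2], including the boundary cases where the coefficient vanishes. *)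
have mid k : (k <= m.+1)%N -> cbin m k * (qfact (m.+1 - k) * qfact (m.+1 + k))
    = qfact m.*2 * ((1 - p ^+ (m.+1 - k)) * (1 - p ^+ (m.+1 + k))).
  rewrite leq_eqVlt => /predU1P[->|le_km].
    by rewrite cbin_small // subnn subrr !(mul0r, mulr0).
  by rewrite -(IHm k) // subSn // addSn !qfactS; ring.
have up k : (k <= m.+1)%N -> cbin m k.+1 * (qfact (m.+1 - k) * qfact (m.+1 + k))
    = qfact m.*2 * ((1 - p ^+ (m - k)) * (1 - p ^+ (m.+1 - k))).
  move=> le_km; have [lt_km|le_mk] := ltnP k m.
    rewrite -(IHm k.+1) //.
    have [->->]: (m.+1 - k = (m - k.+1).+2 /\ m - k = (m - k.+1).+1)%N by lia.
    by rewrite addSnnS !qfactS; ring.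
  by rewrite cbin_small // (eqP le_mk) subrr !(mul0r, mulr0).
have down k : (k <= m)%N -> cbin m k * (qfact (m - k) * qfact (m + k).+2)
    = qfact m.*2 * ((1 - p ^+ (m + k).+1) * (1 - p ^+ (m + k).+2)).
  by move=> le_km; rewrite -(IHm k) // !qfactS; ring.
rewrite doubleS [qfact m.*2.+2]qfactS [qfact m.*2.+1]qfactS /=.
rewrite 2!mulrDl -!mulrA mid // up //.
case: n le_nm => [|n] le_nm.
  by rewrite -mulrA up // !subn0 !addn0 -addnn -!addnS !exprD !exprS; ring.
rewrite -mulrA subSS !addSn !addnS down //.
have [->|ne_nm] := eqVneq n m.
  by rewrite subnn -addnn !subrr; ring.
move: (qfact _) => Q; have [v ->]: exists v, m = (v + n.+1)%N.
  by exists (m - n.+1)%N; lia.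
rewrite addnK addnS subSn ?leq_addl // addnK -addnn.
by rewrite !(addnS, addSn) !exprS !exprD; ring.
Qed.

Variables a b : R.
Hypothesis ab_p : a * b = p.

(* The terms of index n and - n of the theta series, taken together. *)
Definition theta (n : nat) : R :=
  if n is 0 then 1 else (-1) ^+ n * p ^+ 'C(n, 2) * (a ^+ n + b ^+ n).

(** Expand (a + b)(a^(n+1) + b^(n+1)). Index 0 is counted once in [theta], whereas a^0 + b^0 = 2,
    whence the extra factor at n = 0. *)
Lemma thetaS n : p ^+ n.+1 * - (a + b) * theta n.+1
  = theta n.+2 + p ^+ (n.+1).*2 * theta n * (1 + (n == 0)%:R).
Proof.
rewrite /theta -ab_p; case: n => [|n].
  by rewrite (_ : 'C(1, 2) = 0%N) // (_ : 'C(2, 2) = 1%N) // eqxx -addnn mulr1n; ring.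
have ->: 'C(n.+3, 2) = ('C(n.+1, 2) + n.+1 + n.+2)%N by rewrite !(binS _ 1) !bin1.
have ->: 'C(n.+2, 2) = ('C(n.+1, 2) + n.+1)%N by rewrite !(binS _ 1) !bin1.
by move: 'C(_, _) => k; rewrite /= addr0 -addnn !exprD !exprS !exprMn; ring.
Qed.

(** Induction on m: as ab = p, the new factor is 1 + p^(2m+1) - (a+b) p^m. By [thetaS] its last term
    moves index n to n+1 and n-1, which reproduces the recurrence of [cbin]. *)
Lemma finite_triple_product m :
  \prod_(0 <= i < m) ((1 - a * p ^+ i) * (1 - b * p ^+ i))
  = \sum_(0 <= n < m.+1) theta n * cbin m n.
Proof.
elim: m => [|m IHm]; first by rewrite big_geq // big_nat1 mulr1.
rewrite big_nat_recr //= {}IHm big_distrl /=.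
(* The share of the n-th term that moves to index n - 1. *)
pose lower n := if n is n'.+1 then
  p ^+ (m + n'.+1) * theta n' * cbin m n * (1 + (n' == 0)%:R) else 0.
have expand n : (n < m.+1)%N ->
    theta n * cbin m n * ((1 - a * p ^+ m) * (1 - b * p ^+ m)) =
    theta n * (1 + p ^+ m.*2.+1) * cbin m n
    + p ^+ (m - n) * theta n.+1 * cbin m n + lower n.
  case: n => [_|n]; rewrite /lower.
    rewrite subn0 addr0 /theta bin_small // expr0 expr1 exprS -addnn exprD -ab_p.
    ring.
  rewrite ltnS => le_nm; set v := (m - n.+1)%N; have ->: m = (v + n.+1)%N by lia.
  have ->: p ^+ v * theta n.+2 = p ^+ v * (p ^+ n.+1 * - (a + b) * theta n.+1)
     - p ^+ v * (p ^+ (n.+1).*2 * theta n * (1 + (n == 0)%:R)).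
    by rewrite thetaS; ring.
  by rewrite !(addnS, addSn) -!addnn !(addnS, addSn) !exprS !exprD -ab_p; ring.
rewrite big_nat_cond (eq_bigr (fun n => theta n * (1 + p ^+ m.*2.+1) * cbin m n
    + p ^+ (m - n) * theta n.+1 * cbin m n + lower n)); last first.
  by move=> n /andP[/andP[_ lt_n] _]; rewrite expand.
rewrite -big_nat_cond.
have cbinS n : theta n * cbin m.+1 n = theta n * (1 + p ^+ m.*2.+1) * cbin m n
    + theta n * p ^+ (m + n).+1 * cbin m n.+1
    + theta n * (if n is n'.+1 then p ^+ (m - n') * cbin m n'
                 else p ^+ m.+1 * cbin m 1).
  by rewrite /= 2!mulrDr !mulrA.
rewrite [RHS](eq_bigr _ (fun n _ => cbinS n)) !big_split /=.
rewrite [X in _ = X + _ + _]big_nat_recr //= [X in _ = _ + X + _]big_nat_recr //=.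
rewrite [X in _ = _ + (X + _) + _]big_nat_recr //= [X in _ = _ + _ + X]big_nat_recl //=.
rewrite (cbin_small (ltnSn m)) (cbin_small (leqW (ltnSn m))) !mulr0 !addr0.
rewrite [X in _ + _ + X = _]big_nat_recl //= add0r.
(* The doubled contribution to index 0 gives the extra summand, which is the n = 0 branch of
   [cbin]. *)
have -> : \sum_(0 <= n < m) lower n.+1 =
    \sum_(0 <= n < m) theta n * p ^+ (m + n).+1 * cbin m n.+1
    + p ^+ m.+1 * cbin m 1.
  have lowerS n : lower n.+1 = theta n * p ^+ (m + n).+1 * cbin m n.+1
      + (n == 0)%:R * (p ^+ m.+1 * cbin m 1).
    by rewrite /lower addnS; case: n => [|n]; rewrite ?addn0 ?eqxx /=; ring.
  under eq_bigr do rewrite lowerS.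
  rewrite big_split /=; congr (_ + _); case: (m) => [|k].
    by rewrite big_geq // cbin_small ?mulr0.
  rewrite big_nat_recl // eqxx mul1r big1 ?addr0 // => n _.
  by rewrite mul0r.
rewrite mul1r.
rewrite [X in _ = _ + (_ + X)](eq_bigr (fun n =>
  p ^+ (m - n) * theta n.+1 * cbin m n)) => [|n _]; last by rewrite /theta; ring.
by ring.
Qed.

End FiniteTripleProduct.

(** * Generating functions modulo q^(N+1) *)

Section Truncated.

Local Open Scope ring_scope.

Variables (R : comNzRingType) (N : nat) (q : R).
Hypothesis q_nil : q ^+ N.+1 = 0.

Lemma expr_trunc n : (N < n)%N -> q ^+ n = 0.
Proof. by move=> lt_Nn; rewrite -(subnK lt_Nn) exprD q_nil mulr0. Qed.

(** The geometric series, finite because q is nilpotent, is an inverse. *)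
Lemma lreg_1subX n : (0 < n)%N -> GRing.lreg (1 - q ^+ n).
Proof.
move=> n_gt0; apply: (@can_inj _ _ _ ( *%R (\sum_(i < N.+1) (q ^+ n) ^+ i))) => x.
rewrite mulrA [X in X * x]mulrC -opprB mulNr -subrX1 -exprM expr_trunc; last nia.
by rewrite sub0r opprK mul1r.
Qed.

Lemma lreg_prod_1subX c n : (0 < c)%N ->
  GRing.lreg (\prod_(1 <= i < n.+1) (1 - q ^+ (c * i))).
Proof.
move=> c_gt0; rewrite big_nat_cond; elim/big_rec: _ => [|i x].
  exact: lreg1.
rewrite andbT => /andP[i_gt0 _] reg_x.
by apply/lregM/reg_x/lreg_1subX; rewrite muln_gt0 c_gt0.
Qed.

(** * Summing over the halves of the parts of pi *)

Definition distinct_gf (E : seq nat) (t : nat) : R :=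
  \prod_(t.+1 <= i < N.+1 | i \notin E) (1 + q ^+ i).

Lemma distinct_gfS E t : distinct_gf E t =
  (if t.+1 \in E then 1 else 1 + q ^+ t.+1) * distinct_gf E t.+1.
Proof.
rewrite /distinct_gf; have [lt_tN|le_Nt] := ltnP t N.
  by rewrite big_ltn_cond //; case: (_ \in E); rewrite /= ?mul1r.
by rewrite expr_trunc // addr0 if_same mul1r !big_geq // ltnW.
Qed.

Lemma eq_distinct_gf E F t : {in [pred i | (t < i)%N], E =i F} ->
  distinct_gf E t = distinct_gf F t.
Proof.
move=> eqEF; rewrite /distinct_gf big_nat_cond [RHS]big_nat_cond.
apply: eq_bigl => i; case: (ltnP t i) => //= lt_ti.
by congr (_ && (~~ _)); exact: eqEF.
Qed.

(* The pairs (pi, lambda) where pi has r parts, all with halves > a, and lambda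
   has only parts > t. *)
Definition triple_gf (d r c t a : nat) : R :=
  \sum_(s <- gap2_lists N r a)
     q ^+ (2 * sumn s) * distinct_gf (shifted_triples d c s) t.

Lemma triple_gf_big d r c t a : (N <= a)%N -> triple_gf d r.+1 c t a = 0.
Proof. by move=> le_Na; rewrite /triple_gf gap2_listsS ltnNge le_Na big_nil. Qed.

(* Either the first triple is {t+1, t+2, t+3}, or t+1 lies in no triple. *)
Lemma triple_gf_free d r c t a : (a + c = t.+1)%N ->
  triple_gf d r.+1 c t a =
    q ^+ (2 * a.+1) * triple_gf d r (c + d) t.+3 a.+2
    + (1 + q ^+ t.+1) * triple_gf d r.+1 c t.+1 a.+1.
Proof.
move=> eq_t; have [le_Na|lt_aN] := leqP N a.
  by rewrite !triple_gf_big ?(@expr_trunc (2 * _)) ?mul0r ?mulr0 ?addr0 //; lia.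
rewrite {1}/triple_gf gap2_listsS lt_aN big_cat big_map /=.
rewrite !big_distrr /=; congr (_ + _); apply: eq_big_seq => s s_in.
  rewrite /= mulnDr exprD -mulrA; congr (_ * (_ * _)).
  (* The least triple is {t+1, t+2, t+3}: these three factors become 1, and beyond t+3 it excludes
     nothing. *)
  rewrite 3![distinct_gf (_ :: _) _]distinct_gfS addSn eq_t /= !inE !eqxx !orbT !mul1r.
  apply: eq_distinct_gf => i; rewrite !inE => ?.
  by do 3![case: eqP => [|_]; first lia].
rewrite mulrCA; congr (_ * _); rewrite distinct_gfS ifN //.
by apply/negP => /(@shifted_triples_ge _ _ r.+1 _ _ _ _ s_in); lia.
Qed.

(* Here the first triple may also be {t, t+1, t+2}. *)
Lemma triple_gf_shared d r c t a : (a + c = t)%N ->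
  triple_gf d r.+1 c t a =
    q ^+ (2 * a.+1) * triple_gf d r (c + d) t.+2 a.+2
    + triple_gf d r.+1 c t a.+1.
Proof.
move=> eq_t; have [le_Na|lt_aN] := leqP N a.
  by rewrite !triple_gf_big ?(@expr_trunc (2 * _)) ?mul0r ?mulr0 ?addr0 //; lia.
rewrite {1}/triple_gf gap2_listsS lt_aN big_cat big_map /=.
rewrite !big_distrr /=; congr (_ + _); apply: eq_big_seq => s s_in.
rewrite /= mulnDr exprD -mulrA; congr (_ * (_ * _)).
rewrite 2![distinct_gf (_ :: _) _]distinct_gfS addSn eq_t /= !inE !eqxx !orbT !mul1r.
apply: eq_distinct_gf => i; rewrite !inE => ?.
by do 3![case: eqP => [|_]; first lia].
Qed.

(** Induction on r and, within it, downward on a from N. Once a triple is used, a + c - t equals d,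
    so d <= 1 keeps the hypothesis on t alive. The right side is free of c and d, which yields B =
    C. *)
Lemma triple_gfE d r c t a : (d <= 1)%N -> (t <= a + c <= t.+1)%N ->
  triple_gf d r c t a * \prod_(1 <= i < r.+1) (1 - q ^+ (2 * i))
  = q ^+ (2 * r * a + 2 * r ^ 2) * distinct_gf [::] (t + 2 * r).
Proof.
move=> d_le1; elim: r c t a => [|r IHr] c t a at_t.
  rewrite big_geq // /triple_gf big_seq1 mulr1.
  by congr (q ^+ _ * distinct_gf _ _); lia.
have [m] := ubnP (N - a); elim: m t a at_t => // m IHm t a at_t lt_m.
have [le_Na|lt_aN] := leqP N a.
  by rewrite triple_gf_big // expr_trunc ?mul0r //; nia.
have exp_step: (2 * r.+1 * a + 2 * r.+1 ^ 2 =
    2 * a.+1 + (2 * r * a.+2 + 2 * r ^ 2))%N by nia.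
have exp_step1: (2 * r.+1 * a.+1 + 2 * r.+1 ^ 2 =
    2 * a.+1 + (2 * r * a.+2 + 2 * r ^ 2) + 2 * r.+1)%N by nia.
(* The two summands combine by (1 - q^(2r+2)) + q^(2r+2) (1 + q^(t'+1)) = 1 + q^(t'+2r+3), the next
   factor of the product over distinct parts. *)
have free t' : (a + c = t'.+1)%N ->
    triple_gf d r.+1 c t' a * \prod_(1 <= i < r.+2) (1 - q ^+ (2 * i))
    = q ^+ (2 * r.+1 * a + 2 * r.+1 ^ 2) * distinct_gf [::] (t' + 2 * r.+1).
  move=> eq_t; rewrite triple_gf_free // mulrDl -(mulrA (1 + _)) IHm; try lia.
  rewrite big_nat_recr //= (mulrC (\prod_(_ <= _ < _) _)) mulrACA IHr; last lia.
  have ->: (t'.+3 + 2 * r = (t' + 2 * r.+1).+1)%N by lia.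
  have ->: (t'.+1 + 2 * r.+1 = (t' + 2 * r.+1).+1)%N by lia.
  rewrite [distinct_gf _ (t' + _)]distinct_gfS in_nil.
  rewrite exp_step1 exp_step !exprD.
  rewrite -(addn1 (t' + _)%N) -(addn1 t') !exprD.
  by ring.
have [eq_t|neq_t] := eqVneq (a + c)%N t; last by apply: free; lia.
rewrite triple_gf_shared // mulrDl IHm; try lia.
rewrite big_nat_recr //= (mulrC (\prod_(_ <= _ < _) _)) mulrACA IHr; last lia.
have ->: (t.+2 + 2 * r = t + 2 * r.+1)%N by lia.
rewrite exp_step1 exp_step !exprD.
by ring.
Qed.

Lemma triple_gf_indep r : triple_gf 0 r 0 0 1 = triple_gf 1 r 0 0 1.
Proof.
apply: (@lreg_prod_1subX 2 r) => //.
by rewrite ![_ * triple_gf _ _ _ _ _]mulrC !triple_gfE.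
Qed.

Lemma prod_1subX_trunc (P : pred nat) c n : (0 < c)%N -> (N <= n)%N ->
  \prod_(1 <= i < n.+1 | P i) (1 - q ^+ (c * i))
  = \prod_(1 <= i < N.+1 | P i) (1 - q ^+ (c * i)).
Proof.
move=> c_gt0 le_Nn; rewrite (@big_cat_nat _ _ _ N.+1) //=.
rewrite [X in _ * X]big_nat_cond [X in _ * X]big1 ?mulr1 // => i.
by rewrite -andbA => /and3P[lt_Ni _ _]; rewrite expr_trunc ?subr0 //; nia.
Qed.

(** * Andrews' series and their recursion in s *)

Definition shifted_qfact (n s : nat) : R :=
  \prod_(1 <= j < s.+1) (1 - q ^+ (n + j)).

(** With [shifted_qfact n s] read as (q^(n+1); q)_s, this lemma and the next absorb a factor at its
    upper and lower end. *)
Lemma shifted_qfactSr n s :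
  shifted_qfact n s * (1 - q ^+ (n + s.+1)) = shifted_qfact n s.+1.
Proof. by rewrite /shifted_qfact [RHS]big_nat_recr. Qed.

Lemma shifted_qfactSl n s :
  (1 - q ^+ n.+1) * shifted_qfact n.+1 s = shifted_qfact n s.+1.
Proof.
rewrite /shifted_qfact [RHS]big_nat_recl // addn1; congr (_ * _).
by apply: eq_bigr => i _; rewrite addSnnS.
Qed.

(* Andrews' J_{3,i}(q^s; q), multiplied by (q; q)_oo. *)
Definition gordon_term (i s n : nat) : R :=
  (-1) ^+ n * q ^+ (3 * n * s + 7 * 'C(n, 2) + (7 - i) * n)
  * (1 - q ^+ (i * (s + 2 * n).+1)) * shifted_qfact n s.

Definition gordon_sum (i s : nat) : R :=
  \sum_(0 <= n < N.+1) gordon_term i s n.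

(** This is J_{3,i+1}(x) - J_{3,i}(x) = (xq)^i J_{3,3-i}(xq) at x = q^s. *)
Lemma gordon_sum_rec i s : (i <= 2)%N ->
  gordon_sum i.+1 s =
  gordon_sum i s + q ^+ (s.+1 * i) * gordon_sum (3 - i) s.+1.
Proof.
move=> i_le2; apply/eqP; rewrite addrC -subr_eq; apply/eqP.
(* The difference of the n-th terms splits into a multiple of 1 - q^n and a multiple of 1 -
   q^(n+s+1); the latter factor is absorbed into [shifted_qfact n s.+1]. *)
pose a n := (-1) ^+ n * q ^+ (3 * n * s + 7 * 'C(n, 2) + (6 - i) * n)
  * (1 - q ^+ n) * shifted_qfact n s.
pose b n := (-1) ^+ n * q ^+ (3 * n * s + 7 * 'C(n, 2) + (7 + i) * n + i * s.+1)
  * shifted_qfact n s.+1.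
have aSb n : a n.+1 + b n = q ^+ (s.+1 * i) * gordon_term (3 - i) s.+1 n.
  rewrite /a /b /gordon_term -(mulrA _ (1 - _)) shifted_qfactSl binS bin1 exprS.
  have ->: (3 * n.+1 * s + 7 * ('C(n, 2) + n) + (6 - i) * n.+1 =
    3 * n * s + 7 * 'C(n, 2) + (7 + i) * n + i * s.+1
     + (3 - i) * (s.+1 + 2 * n).+1)%N by nia.
  have eqb: (3 * n * s + 7 * 'C(n, 2) + (7 + i) * n + i * s.+1 =
    s.+1 * i + (3 * n * s.+1 + 7 * 'C(n, 2) + (7 - (3 - i)) * n))%N by nia.
  by rewrite exprD eqb [q ^+ (s.+1 * i + _)]exprD; ring.
have ab n : gordon_term i.+1 s n - gordon_term i s n = a n + b n.
  rewrite /a /b /gordon_term -shifted_qfactSr.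
  have ->: (7 - i.+1 = 6 - i)%N by lia.
  have ->: (3 * n * s + 7 * 'C(n, 2) + (7 - i) * n =
    3 * n * s + 7 * 'C(n, 2) + (6 - i) * n + n)%N by nia.
  have ->: (3 * n * s + 7 * 'C(n, 2) + (7 + i) * n + i * s.+1 =
    3 * n * s + 7 * 'C(n, 2) + (6 - i) * n + n + i * (s + 2 * n).+1)%N by nia.
  have ->: (i.+1 * (s + 2 * n).+1 = i * (s + 2 * n).+1 + n + (n + s.+1))%N by nia.
  by move: (_ + (6 - i) * n)%N (i * _)%N => e w; rewrite !exprD; ring.
(* As a 0 = 0 and a (N + 1) = 0, summing a n + b n or a (n + 1) + b n is the
   same. *)
rewrite /gordon_sum -sumrB (eq_bigr _ (fun n _ => ab n)) big_split /=.
rewrite big_distrr (eq_bigr _ (fun n _ => esym (aSb n))) big_split /=.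
congr (_ + _); rewrite big_nat_recl // [RHS]big_nat_recr //=.
rewrite {1}/a subrr mulr0 mul0r add0r [X in _ + X](_ : _ = 0) ?addr0 //.
by rewrite /a expr_trunc ?mulr0 ?mul0r //; nia.
Qed.

Lemma gordon_sum0 s : gordon_sum 0 s = 0.
Proof.
by apply: big1 => n _; rewrite /gordon_term mul0n subrr mulr0 mul0r.
Qed.

(** The initial value for the downward recursion: only the term n = 0 survives. *)
Lemma gordon_sum_big i s : (0 < i <= 3)%N -> (N <= s)%N ->
  gordon_sum i s = \prod_(1 <= j < N.+1) (1 - q ^+ j).
Proof.
move=> i_in le_Ns; rewrite /gordon_sum [LHS]big_nat_recl // big1 ?addr0 => [|n _].
  rewrite /gordon_term !muln0 addn0 expr0 mul1r mul1r.
  rewrite (@expr_trunc (i * _)) ?subr0 ?mul1r; last nia.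
  under [RHS]eq_bigr do rewrite -[i in q ^+ i]mul1n.
  rewrite -(@prod_1subX_trunc xpredT 1 s) //.
  by apply: eq_bigr => j _; rewrite mul1n.
by rewrite /gordon_term expr_trunc ?mulr0 ?mul0r //; nia.
Qed.

(** * Matching the pairs counted by B with Andrews' series *)

Definition triple_sum (t a : nat) : R :=
  \sum_(0 <= r < N.+1) triple_gf 0 r 0 t a.

(** The factor q^(2r^2) of the closed form vanishes at r = N+1; this permits shifting r by one in
    [triple_sum]. *)
Lemma triple_gf_eq0 t a : (t <= a <= t.+1)%N -> triple_gf 0 N.+1 0 t a = 0.
Proof.
move=> at_t; apply: (@lreg_prod_1subX 2 N.+1) => //.
by rewrite mulr0 mulrC triple_gfE ?addn0 // expr_trunc ?mul0r //; nia.
Qed.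

Lemma triple_sumE t a : (t <= a <= t.+1)%N ->
  triple_sum t a = distinct_gf [::] t
                   + \sum_(0 <= r < N.+1) triple_gf 0 r.+1 0 t a.
Proof.
move=> at_t; rewrite /triple_sum big_nat_recl // big_nat_recr //=.
by rewrite triple_gf_eq0 // addr0 {1}/triple_gf big_seq1 mul1r.
Qed.

Lemma triple_sum_free t : triple_sum t t.+1 =
  (1 + q ^+ t.+1) * triple_sum t.+1 t.+2 + q ^+ (2 * t.+2) * triple_sum t.+3 t.+3.
Proof.
rewrite (@triple_sumE t t.+1) ?leqnn ?leqnSn // distinct_gfS //=.
rewrite (@triple_sumE t.+1 t.+2) ?leqnn ?leqnSn // mulrDr -addrA.
congr (_ + _); rewrite !big_distrr -big_split /=.
by apply: eq_bigr => r _; rewrite triple_gf_free ?addn0 // addrC.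
Qed.

Lemma triple_sum_shared t : triple_sum t t =
  triple_sum t t.+1 + q ^+ (2 * t.+1) * triple_sum t.+2 t.+2.
Proof.
rewrite (@triple_sumE t t) ?leqnn ?leqnSn // (@triple_sumE t t.+1) ?leqnn ?leqnSn //.
rewrite -addrA; congr (_ + _); rewrite big_distrr -big_split /=.
by apply: eq_bigr => r _; rewrite triple_gf_shared ?addn0 // addrC.
Qed.

Lemma triple_sum_big t a : (N <= t)%N -> (t <= a <= t.+1)%N -> triple_sum t a = 1.
Proof.
move=> le_Nt at_t; rewrite triple_sumE // /distinct_gf big_geq //.
by rewrite big1 ?addr0 // => r _; rewrite triple_gf_big //; lia.
Qed.

(** Halves above t+1 mean f_(t+1) <= 1, the case i = 2; halves above t allow f_(t+1) = 2, the case i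
    = 3. Both sides obey the same recursions and agree for t >= N. *)
Lemma triple_sum_gordon t :
  (\prod_(1 <= j < N.+1) (1 - q ^+ j)) * triple_sum t t.+1 = gordon_sum 2 t
  /\ (\prod_(1 <= j < N.+1) (1 - q ^+ j)) * triple_sum t t = gordon_sum 3 t.
Proof.
have [m] := ubnP (N - t); elim: m t => // m IHm t lt_m.
have [le_Nt|lt_tN] := leqP N t.
  by rewrite !triple_sum_big ?leqnn ?leqnSn // !mulr1 !gordon_sum_big.
have [|G2S G3S1] := IHm t.+1; first lia.
have [|_ G3S2] := IHm t.+2; first lia.
have [|_ G3S3] := IHm t.+3; first lia.
have H13 s : gordon_sum 1 s = gordon_sum 3 s.+1.
  by rewrite (@gordon_sum_rec 0) // gordon_sum0 add0r muln0 mul1r.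
have H2: (\prod_(1 <= j < N.+1) (1 - q ^+ j)) * triple_sum t t.+1 = gordon_sum 2 t.
  rewrite triple_sum_free (@gordon_sum_rec 1) // H13 (@gordon_sum_rec 2) // H13.
  by rewrite -G2S -G3S3 muln1 (mulnC 2); ring.
split=> //.
by rewrite triple_sum_shared (@gordon_sum_rec 2) // H13 -H2 -G3S2 (mulnC 2); ring.
Qed.

(** * Jacobi's triple product modulo q^(N+1) *)

Lemma qfactX c n :
  qfact (q ^+ c) n = \prod_(1 <= i < n.+1) (1 - q ^+ (c * i)).
Proof. by apply: eq_bigr => i _; rewrite exprM. Qed.

Lemma qfact_trunc c n : (0 < c)%N -> (N <= n)%N ->
  qfact (q ^+ c) n = qfact (q ^+ c) N.
Proof. by move=> c_gt0 le_Nn; rewrite !qfactX prod_1subX_trunc. Qed.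

Lemma lreg_qfact c n : (0 < c)%N -> GRing.lreg (qfact (q ^+ c) n).
Proof. by move=> c_gt0; rewrite qfactX; apply: lreg_prod_1subX. Qed.

(** As m - n, m + n and 2m are all at least N, the three factorials in [cbinE] agree modulo
    q^(N+1). *)
Lemma cbin_trunc c m n : (0 < c)%N -> (n <= N)%N -> (N.*2 <= m)%N ->
  qfact (q ^+ c) N * cbin (q ^+ c) m n = 1.
Proof.
move=> c_gt0 le_nN le_Nm; apply: (@lreg_qfact c N c_gt0).
have le_nm: (n <= m)%N by lia.
have := cbinE (q ^+ c) le_nm; rewrite !(@qfact_trunc c) //; try lia.
by move=> def_c; rewrite mulr1 -[RHS]def_c; ring.
Qed.

(* Jacobi's triple product for (q^2, q^5, q^7; q^7)_oo. *)
Lemma gordon_sum_triple_product :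
  qfact (q ^+ 7) N * \prod_(0 <= i < N.*2)
    ((1 - q ^+ 2 * (q ^+ 7) ^+ i) * (1 - q ^+ 5 * (q ^+ 7) ^+ i))
  = gordon_sum 2 0.
Proof.
rewrite (@finite_triple_product _ (q ^+ 7)) -?exprD // big_distrr /=.
rewrite (@big_cat_nat _ _ _ N.+1) //=; last lia.
rewrite [X in _ + X]big_nat_cond [X in _ + X]big1 ?addr0; last first.
  move=> [|n] /andP[/andP[lt_Nn _] _] //.
  rewrite /theta -!exprM (@expr_trunc (2 * _)) ?(@expr_trunc (5 * _)); try lia.
  by rewrite !(addr0, mulr0, mul0r).
rewrite big_nat_cond (eq_bigr (theta (q ^+ 7) (q ^+ 2) (q ^+ 5))); last first.
  move=> n /andP[/andP[_ lt_nN] _].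
  by rewrite mulrCA cbin_trunc ?mulr1.
rewrite -big_nat_cond.
(* The n-th term at s = 0 joins the q^5 half of [theta n] to the q^2 half of [theta n.+1];
   regrouping by index restores [theta]. *)
rewrite [RHS](eq_bigr (fun n => (-1) ^+ n * q ^+ (7 * 'C(n, 2) + 5 * n)
  + (-1) ^+ n.+1 * q ^+ (7 * 'C(n.+1, 2) + 2 * n.+1))) => [|n _]; last first.
  rewrite /gordon_term /shifted_qfact big_geq // mulr1 muln0 add0n.
  have ->: (7 * 'C(n.+1, 2) + 2 * n.+1 = 7 * 'C(n, 2) + 5 * n + 2 * (0 + 2 * n).+1)%N.
    by rewrite binS bin1; lia.
  by rewrite exprS [q ^+ (_ + 2 * _)]exprD; ring.
rewrite big_split /= [X in _ = X + _]big_nat_recl // [X in _ = _ + X]big_nat_recr //=.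
rewrite (@expr_trunc (_ + 2 * N.+1)) ?mulr0 ?addr0; last lia.
rewrite big_nat_recl // -addrA -big_split /= mul1r; congr (_ + _).
by apply: eq_bigr => n _; rewrite /theta -!exprM !exprD; ring.
Qed.

(** * Generating functions of the enumerations *)

Lemma gf_count (T : Type) (w : T -> nat) (s : seq T) :
  \sum_(x <- s) q ^+ w x
  = \sum_(0 <= m < N.+1) (count (fun x => w x == m) s)%:R * q ^+ m.
Proof.
elim: s => [|x s IHs]; first by rewrite big_nil big1 // => m _; rewrite mul0r.
rewrite big_cons IHs; under [RHS]eq_bigr do rewrite /= natrD mulrDl.
rewrite big_split; congr (_ + _); have [le_wN|lt_Nw] := leqP (w x) N.
  rewrite (bigD1_seq (w x)) ?mem_index_iota ?iota_uniq //= eqxx mul1r.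
  by rewrite big1 ?addr0 // => m /negPf; rewrite eq_sym => ->; rewrite mul0r.
rewrite expr_trunc // big_nat_cond big1 // => m /andP[/andP[_ lt_mN] _].
by have /negPf->: w x != m by [lia]; rewrite mul0r.
Qed.

Lemma mult_lists_gf c m : \sum_(l <- mult_lists c m) q ^+ sumn l
  = \prod_(1 <= i < m.+1) \sum_(0 <= k < c i) (q ^+ i) ^+ k.
Proof.
elim: m => [|m IHm]; first by rewrite big_seq1 big_geq.
rewrite big_nat_recr //= -IHm big_allpairs_dep big_distrlr [RHS]exchange_big /=.
rewrite /index_iota subn0; apply: eq_bigr => k _; apply: eq_bigr => l _.
by rewrite sumn_cat sumn_nseq exprD exprM mulrC.
Qed.

Lemma distinct_lists_gf E :
  \sum_(l <- mult_lists (distinct_bound E) N) q ^+ sumn l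
  = distinct_gf E 0.
Proof.
rewrite mult_lists_gf /distinct_gf [RHS]big_mkcond.
apply: eq_bigr => i _; rewrite /distinct_bound; case: (i \in E).
  by rewrite big_nat1.
by rewrite big_nat_recr // big_nat1.
Qed.

Lemma bipart_lists_gf d :
  \sum_(b <- bipart_lists d N) q ^+ (sumn b.1 + sumn b.2)
  = \sum_(0 <= r < N.+1) triple_gf d r 0 0 1.
Proof.
rewrite /bipart_lists big_allpairs_dep /gap_part_halves big_flatten big_map.
rewrite /index_iota subn0; apply: eq_bigr => r _; apply: eq_bigr => s _ /=.
rewrite -distinct_lists_gf big_distrr; apply: eq_bigr => l _.
rewrite exprD sumn_rev; congr (q ^+ _ * _).
by elim: s => //= x s ->; lia.
Qed.

Lemma pm13_mod7D m i : pm13_mod7 (7 * m + i) = pm13_mod7 i.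
Proof. by rewrite /pm13_mod7 /congr_pm mulnC -!addnA !modnMDl. Qed.

(** Induction over blocks of seven: residues 1, 3, 4, 6 go to the first product, 0 to [qfact], and
    2, 5 to the last. *)
Lemma qfact_mod7 m :
  \prod_(1 <= i < (7 * m).+1) (1 - q ^+ i)
  = \prod_(1 <= i < (7 * m).+1 | pm13_mod7 i) (1 - q ^+ i)
    * (qfact (q ^+ 7) m * \prod_(0 <= i < m)
    ((1 - q ^+ 2 * (q ^+ 7) ^+ i) * (1 - q ^+ 5 * (q ^+ 7) ^+ i))).
Proof.
elim: m => [|m IHm]; first by rewrite /qfact !big_geq // !mulr1.
have -> : (7 * m.+1 = (7 * m).+4.+3)%N by lia.
have split7 (P : pred nat) :
    \prod_(1 <= i < (7 * m).+4.+4 | P i) (1 - q ^+ i) =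
    \prod_(1 <= i < (7 * m).+1 | P i) (1 - q ^+ i) *
    \prod_(1 <= i < 8 | P (7 * m + i)%N) (1 - q ^+ (7 * m + i)).
  rewrite (@big_cat_nat _ _ _ (7 * m).+1) //=; last lia.
  rewrite [X in _ * X](_ : _ = \prod_(1 + 7 * m <= i < 8 + 7 * m | P i) (1 - q ^+ i)).
    by rewrite big_addn addnK; congr (_ * _); apply: eq_big => i; rewrite addnC.
  by congr (bigop _ _ _); congr index_iota; lia.
rewrite !split7 {}IHm (eq_bigl pm13_mod7 _ (pm13_mod7D m)) qfactS.
rewrite [\prod_(0 <= i < m.+1) _]big_nat_recr //=.
rewrite -!exprM mulnS; move: (7 * m)%N => k.
move: (bigop _ _ _) (qfact _ m) (\prod_(0 <= i < m) _) => x y z.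
rewrite /index_iota /= !big_cons !big_nil /pm13_mod7 /congr_pm /= !exprD.
by ring.
Qed.

Lemma part_gf :
  (\sum_(l <- mult_lists (part_bound N) N) q ^+ sumn l)
  * \prod_(1 <= i < N.+1 | pm13_mod7 i) (1 - q ^+ i) = 1.
Proof.
rewrite mult_lists_gf [X in _ * X]big_mkcond -big_split big_nat_cond big1 // => i /=.
rewrite andbT => /andP[i_gt0 _]; rewrite /part_bound.
case: (pm13_mod7 i); last by rewrite big_nat1 mulr1.
rewrite mulrC -opprB mulNr big_mkord -subrX1 -exprM expr_trunc ?sub0r ?opprK //.
nia.
Qed.

Lemma part_gf_eq :
  \sum_(l <- mult_lists (part_bound N) N) q ^+ sumn l
  = \sum_(b <- bipart_lists 0 N) q ^+ (sumn b.1 + sumn b.2).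
Proof.
apply: (@lreg_qfact 1 N) => //.
have := triple_sum_gordon 0; rewrite -gordon_sum_triple_product // => -[].
rewrite /triple_sum -bipart_lists_gf => eq_B _.
have qfact1 m : qfact (q ^+ 1) m = \prod_(1 <= j < m.+1) (1 - q ^+ j).
  by rewrite expr1.
(* The product is extended to 7 * 2N, which gives the 2N blocks used in the triple product. *)
rewrite [in RHS]qfact1 eq_B -(@qfact_trunc 1 (7 * N.*2)) //; last lia.
rewrite qfact1 qfact_mod7.
rewrite -(@qfact_trunc 7 N.*2) //; last lia.
rewrite mulrC mulrA.
have -> : \prod_(1 <= i < (7 * N.*2).+1 | pm13_mod7 i) (1 - q ^+ i) =
   \prod_(1 <= i < N.+1 | pm13_mod7 i) (1 - q ^+ i).
  have mul1 m : \prod_(1 <= i < m.+1 | pm13_mod7 i) (1 - q ^+ i) =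
      \prod_(1 <= i < m.+1 | pm13_mod7 i) (1 - q ^+ (1 * i)).
    by apply: eq_bigr => i _; rewrite mul1n.
  by rewrite !mul1 prod_1subX_trunc //; lia.
by rewrite part_gf mul1r.
Qed.

End Truncated.

(** * Reading off coefficients *)

Section Coefficients.

Local Open Scope ring_scope.

(** Take Z[X]/(X^(N+1)) with q the class of X: representatives of degree at most N are unique, and
    the naturals embed in Z. *)
Lemma truncated_ring (N : nat) : exists (R : comNzRingType) (q : R),
  q ^+ N.+1 = 0 /\ forall f g : nat -> nat,
    \sum_(0 <= m < N.+1) (f m)%:R * q ^+ m
    = \sum_(0 <= m < N.+1) (g m)%:R * q ^+ m -> f N = g N.
Proof.
pose h : {poly int} := 'X^(N.+1).
have size_h : size (mk_monic h) = N.+2 by rewrite mk_monic_Xn size_polyXn.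
exists {poly %/ h}, (in_qpoly h 'X); split.
  rewrite -rmorphXn /=; apply: val_inj => /=.
  by rewrite mk_monic_Xn Pdiv.RingMonic.rmodpp ?monicXn.
move=> f g.
have to_poly (e : nat -> nat) : (\sum_(0 <= m < N.+1) (e m)%:R * in_qpoly h 'X ^+ m
    : {poly %/ h}) = \poly_(m < N.+1) (e m)%:R :> {poly int}.
  rewrite -[RHS](@in_qpoly_small _ h); last first.
    by rewrite size_h ltnS size_poly.
  congr (val _); rewrite poly_def rmorph_sum big_mkord; apply: eq_bigr => m _ /=.
  by rewrite scaler_nat rmorphMn rmorphXn /= mulr_natl.
move/(congr1 (@polyn _ _))/(congr1 (fun r : {poly int} => r`_N)).
by rewrite !to_poly !coef_poly ltnSn => /eqP; rewrite Num.Theory.eqr_nat => /eqP.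
Qed.

Lemma eq_count_gf (T U : Type) (w : T -> nat) (v : U -> nat)
    (s : seq T) (t : seq U) (n : nat) :
  (forall (R : comNzRingType) (q : R), q ^+ n.+1 = 0 ->
     \sum_(x <- s) q ^+ w x = \sum_(y <- t) q ^+ v y) ->
  count (fun x => w x == n) s = count (fun y => v y == n) t.
Proof.
have [R [q [q_nil coef_inj]]] := truncated_ring n; move/(_ R q q_nil).
rewrite !(gf_count q_nil).
exact: (coef_inj (fun m => count _ s) (fun m => count _ t)).
Qed.

End Coefficients.

Theorem theorem9 (n : nat) (n_gt0 : 0 < n) : A n = B n /\ B n = C n.
Proof.
pose weight (b : seq nat * seq nat) := sumn b.1 + sumn b.2.
rewrite A_count B_count C_count; split.
  apply: (@eq_count_gf _ _ sumn weight) => R q q_nil; exact: part_gf_eq.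
apply: (@eq_count_gf _ _ weight weight) => R q q_nil; rewrite !bipart_lists_gf.
by apply: eq_bigr => r _; rewrite triple_gf_indep.
Qed.
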